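(* Let $X$ be a normed linear space over $K$ (where $K=\mathbb{R}$ or $K=\mathbb{C}$) and let $x_0 \in S_X$. If there exists a Hamel basis of $X$ containing $x_0$ which is strongly orthonormal relative to $x_0$ in the sense of Birkhoff-James, then $x_0$ is an extreme point of $B_X$.
   Context: $S_X=\{x\in X:\|x\|=1\}$ is the unit sphere and $B_X=\{x\in X:\|x\|\le 1\}$ is the unit ball of $X$. A finite set $S=\{x_1,\dots,x_n\}\subset X$ (of distinct elements) is strongly orthogonal relative to an element $x_{i_0}\in S$ in the sense of Birkhoff-James iff $\|x_{i_0}\| < \|x_{i_0}+\sum_{j\neq i_0}\lambda_j x_j\|$ for all scalars $\lambda_j\in K$ ($1\le j\le n$, $j\ne i_0$) that are not all $0$. An infinite set is strongly orthogonal relative to an element contained in it iff every finite subset containing that element is strongly orthogonal relative to that element. The set is called strongly orthonormal relative to the element if, in addition, every element of the set has norm $1$. *)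

(* Defs.v *)
From mathcomp Require Import all_boot all_order all_algebra.
From mathcomp Require Import all_classical all_reals all_analysis.
From mathcomp Require Export complex.

Set Implicit Arguments.
Unset Strict Implicit.
Unset Printing Implicit Defensive.

Import Order.TTheory GRing.Theory Num.Theory.
Import numFieldNormedType.Exports.

Local Open Scope classical_set_scope.
Local Open Scope ring_scope.

Definition linearly_independent (K : fieldType) (X : lmodType K) (B : set X) :=
  forall (F : set X) (a : X -> K), finite_set F -> F `<=` B ->
    \sum_(x \in F) a x *: x = 0 -> forall x, F x -> a x = 0.

Definition spanning (K : fieldType) (X : lmodType K) (B : set X) :=
  forall y : X, exists (F : set X) (a : X -> K),
    [/\ finite_set F, F `<=` B & y = \sum_(x \in F) a x *: x].

Definition hamel_basis (K : fieldType) (X : lmodType K) (B : set X) :=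
  linearly_independent B /\ spanning B.

(* The norm of [X : normedModType K] takes its values in [K]; for [K] the
   complex numbers, [u <= v] and [u < v] hold only if [v - u] is real. *)

Definition unit_sphere (K : numFieldType) (X : normedModType K) : set X :=
  [set x | `|x| = 1].
Arguments unit_sphere {K} X.

Definition unit_ball (K : numFieldType) (X : normedModType K) : set X :=
  [set x | `|x| <= 1].
Arguments unit_ball {K} X.

(* Over the complex numbers, [0 < t < 1] forces [t] to be real. *)
Definition extreme_point (K : numFieldType) (X : lmodType K) (C : set X)
    (x : X) :=
  C x /\ forall (y z : X) (t : K), C y -> C z -> 0 < t < 1 ->
    x = t *: y + (1 - t) *: z -> y = x /\ z = x.

(* The values of [lambda] outside [S `\ x0] are irrelevant. *)
Definition finite_strongly_orthogonal (K : numFieldType) (X : normedModType K)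
    (S : set X) (x0 : X) :=
  [/\ finite_set S, S x0 &
    forall lambda : X -> K, (exists2 x, (S `\ x0) x & lambda x != 0) ->
      `|x0| < `|x0 + \sum_(x \in S `\ x0) lambda x *: x| ].

Definition strongly_orthogonal (K : numFieldType) (X : normedModType K)
    (S : set X) (x0 : X) :=
  [/\ S x0,
      finite_set S -> finite_strongly_orthogonal S x0 &
      infinite_set S -> forall F : set X, finite_set F -> F `<=` S -> F x0 ->
        finite_strongly_orthogonal F x0].

Definition strongly_orthonormal (K : numFieldType) (X : normedModType K)
    (S : set X) (x0 : X) :=
  strongly_orthogonal S x0 /\ forall x, S x -> `|x| = 1.

(* Main.v *)
Require Import Defs.
From mathcomp Require Import all_boot all_order all_algebra.
From mathcomp Require Import all_classical all_reals all_analysis.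
From mathcomp Require Import lra.

(** Let [x0 = t y + (1 - t) z] with [y], [z] in the unit ball. Expanding in the
    basis, [y = a x0 + u] and [z = b x0 + v] where [u], [v] are combinations of
    the other basis vectors and [t a + (1 - t) b = 1]. Orthogonality gives
    [|a| <= |y| <= 1] and [|b| <= |z| <= 1], so [a = b = 1] because 1 is an
    extreme point of the unit ball of the scalar field. Then
    [|x0 + u| <= 1 = |x0|], and strictness in the orthogonality forces [u = 0]. *)

Import Order.TTheory GRing.Theory Num.Theory.
Import numFieldNormedType.Exports.

Local Open Scope classical_set_scope.
Local Open Scope ring_scope.

Lemma scaler_fsumr (K : fieldType) (X : lmodType K) (F : set X) (c : K)
    (f : X -> X) : finite_set F ->
  c *: (\sum_(x \in F) f x) = \sum_(x \in F) c *: f x.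
Proof. by move=> finF; rewrite !fsbig_finite // scaler_sumr. Qed.

(** [x0] may be missing from the support of [y]; it is then adjoined with coefficient 0, so that
    orthogonality relative to [x0] can be applied to [F]. *)
Lemma spanning_split (K : fieldType) (X : lmodType K) (B : set X) (x0 y : X) :
  spanning B -> B x0 ->
  exists (F : set X) (c : K) (a : X -> K), [/\ finite_set F, F `<=` B, F x0 &
    y = c *: x0 + \sum_(x \in F `\ x0) a x *: x].
Proof.
move=> spanB Bx0; have [F [a [finF FB ->]]] := spanB y.
(* The values of [a] outside [F] are arbitrary, hence the cut-off to 0. *)
pose a' x := if x \in F then a x else 0.
exists (F `|` [set x0]), (a' x0), a'; split.
- by rewrite finite_setU; split.
- by move=> x [/FB//|->].
- by right.
- rewrite -(fsbigD1 x0 (F `|` [set x0]) (fun x => a' x *: x)); last 2 first.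
  + by rewrite finite_setU; split.
  + by right.
  rewrite -(fsbig_widen F).
  + by apply: eq_fsbigr => x xF; rewrite /a' xF.
  + by move=> x; left.
  + by move=> x [_ /= nFx]; rewrite /a' memNset// scale0r.
Qed.

(** For infinite [B] this is the definition. For finite [B] the definition speaks of [B] alone, and
    scalars on [F] are extended by 0 to [B]. *)
Lemma strongly_orthogonal_finite_subset (K : numFieldType)
    (X : normedModType K) (B F : set X) (x0 : X) :
  strongly_orthogonal B x0 -> finite_set F -> F `<=` B -> F x0 ->
  finite_strongly_orthogonal F x0.
Proof.
move=> [Bx0 soB_fin soB_inf] finF FB Fx0.
have [finB|infB] := pselect (finite_set B); last exact: soB_inf.
have [_ _ soB] := soB_fin finB; split=> // lambda [x [Fx xx0] lx].
pose l x := if x \in F then lambda x else 0.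
have -> : \sum_(x \in F `\ x0) lambda x *: x = \sum_(x \in B `\ x0) l x *: x.
  rewrite -(fsbig_widen (F `\ x0) (B `\ x0)).
  - by apply: eq_fsbigr => z /set_mem[Fz _]; rewrite /l mem_set.
  - by move=> z [/FB].
  - move=> z [[_ zx0] nFz]; rewrite /preimage /= /l memNset ?scale0r// => Fz.
    exact: nFz.
apply: soB; exists x; first by split=> //; exact: FB.
by rewrite /l mem_set.
Qed.

Section FiniteStronglyOrthogonal.
Variables (K : numFieldType) (X : normedModType K) (F : set X) (x0 : X).
Hypothesis soF : finite_strongly_orthogonal F x0.

Let finF' : finite_set (F `\ x0).
Proof. by case: soF => finF _ _; apply: finite_setD. Qed.

(** A single nonzero coefficient would give the opposite strict inequality, so every term
    vanishes. *)
Lemma fso_sum_eq0 (a : X -> K) :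
  `|x0 + \sum_(x \in F `\ x0) a x *: x| <= `|x0| ->
  \sum_(x \in F `\ x0) a x *: x = 0.
Proof.
case: soF => _ _ so le_x0; apply: fsbig1 => x Fx.
have [->|ax] := eqVneq (a x) 0; first by rewrite scale0r.
have lt_x0 := so a (ex_intro2 _ _ x Fx ax).
by have := lt_le_trans lt_x0 le_x0; rewrite ltxx.
Qed.

(** By homogeneity, dividing by [c != 0] reduces the bound to orthogonality with non-strict
    inequality. *)
Lemma fso_norm_coef (c : K) (a : X -> K) :
  `|c| * `|x0| <= `|c *: x0 + \sum_(x \in F `\ x0) a x *: x|.
Proof.
have [->|c0] := eqVneq c 0; first by rewrite normr0 mul0r.
set u := \sum_(x \in _) _.
have -> : c *: x0 + u = c *: (x0 + \sum_(x \in F `\ x0) (c^-1 * a x) *: x).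
  rewrite scalerDr scaler_fsumr//; congr (_ + _).
  by apply: eq_fsbigr => x _; rewrite scalerA mulVKf.
rewrite normrZ ler_wpM2l//.
(* Orthogonality covers only coefficients that are not all 0; otherwise the sum vanishes and
   equality holds. *)
have [[x Fx ax]|a0] := pselect (exists2 x, (F `\ x0) x & c^-1 * a x != 0).
  by apply: ltW; case: soF => _ _; apply; exists x.
rewrite fsbig1 ?addr0// => x Fx.
have [->|ax] := eqVneq (c^-1 * a x) 0; first by rewrite scale0r.
by case: a0; exists x.
Qed.

End FiniteStronglyOrthogonal.

(** The first hypothesis, extremality of 1 among the scalars, isolates the one step whose proof
    differs between the real and the complex field. *)
Lemma strongly_orthonormal_extreme (K : numFieldType) (X : normedModType K)
    (B : set X) (x0 : X) :
  (forall a b t : K, `|a| <= 1 -> `|b| <= 1 -> 0 < t < 1 ->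
     t * a + (1 - t) * b = 1 -> a = 1) ->
  hamel_basis B -> strongly_orthonormal B x0 ->
  extreme_point (unit_ball X) x0.
Proof.
move=> K1 [_ spanB] [soB normB]; have Bx0 : B x0 by case: soB.
have n1 : `|x0| = 1 by exact: normB.
split=> [|y z t yB zB t01 x0E]; first by rewrite /unit_ball /= n1.
have t1 : 1 - t != 0 by case/andP: t01 => _ t1; rewrite subr_eq0 gt_eqF.
suff yx0 : y = x0.
  split=> //; apply: (scalerI t1); apply: (addrI (t *: y)).
  by rewrite -x0E yx0 -scalerDl addrC subrK scale1r.
have [F [c [a [finF FB Fx0 yE]]]] := spanning_split _ _ _ _ y spanB Bx0.
have soF := strongly_orthogonal_finite_subset _ _ _ _ _ soB finF FB Fx0.
(* Solving [x0 = t *: y + (1 - t) *: z] for [z] yields its coefficients [d] and [b] over the same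
   [F] as for [y]. *)
pose d := (1 - t)^-1 * (1 - t * c).
pose b x := - ((1 - t)^-1 * t) * a x.
have finF' : finite_set (F `\ x0) by exact: finite_setD.
have zE : z = d *: x0 + \sum_(x \in F `\ x0) b x *: x.
  apply: (scalerI t1).
  have -> : (1 - t) *: z = x0 - t *: y.
    by apply: (addrI (t *: y)); rewrite -x0E addrC subrK.
  rewrite yE !scalerDr !scaler_fsumr// !scalerA /d mulVKf// scalerBl scale1r.
  rewrite opprD addrA; congr (_ + _).
  rewrite -scaleN1r scaler_fsumr//; apply: eq_fsbigr => x _.
  rewrite !scalerA; congr (_ *: _).
  by rewrite /b mulN1r !mulNr mulrN -mulrA mulVKf.
have c1 : c = 1.
  apply: (K1 c d t) => //.
  - apply: le_trans (yB : `|y| <= 1).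
    by rewrite yE -[`|c|]mulr1 -n1; exact: fso_norm_coef.
  - apply: le_trans (zB : `|z| <= 1).
    by rewrite zE -[`|d|]mulr1 -n1; exact: fso_norm_coef.
  - by rewrite /d mulVKf// addrC subrK.
move: yE; rewrite c1 scale1r => yE.
by rewrite yE (fso_sum_eq0 _ _ _ _ soF) ?addr0// n1 -yE.
Qed.

Lemma unit_convex_comb_real (R : realFieldType) (a b t : R) :
  `|a| <= 1 -> `|b| <= 1 -> 0 < t < 1 -> t * a + (1 - t) * b = 1 -> a = 1.
Proof.
rewrite !ler_norml => /andP[_ a1] /andP[_ b1] /andP[t0 t1] abE.
(* If [a < 1], then [t * (1 - a) > 0] and [(1 - t) * (1 - b) >= 0] add up to [0 > 0]. *)
apply/eqP; rewrite eq_le a1 /= leNgt; apply/negP => lta; nra.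
Qed.

(** This is the equality case of the triangle inequality: two terms bounded in norm by [t] and
    [1 - t], with sum [t + (1 - t)], must equal their bounds. *)
Lemma unit_convex_comb_closed (C : numClosedFieldType) (a b t : C) :
  `|a| <= 1 -> `|b| <= 1 -> 0 < t < 1 -> t * a + (1 - t) * b = 1 -> a = 1.
Proof.
move=> a1 b1 /andP[t0 t1] abE.
have t'0 : 0 < 1 - t by rewrite subr_gt0.
apply: (mulfI (lt0r_neq0 t0)).
(* The two terms and their bounds become families over [bool], the form that [normC_sum_upper]
   takes. *)
pose F i := if i then t * a else (1 - t) * b.
pose G i := if i then t else 1 - t.
have FG i : true -> `|F i| <= G i.
  by case: i => _; rewrite /F /G normrM gtr0_norm// ler_piMr// ltW.
have /(_ true isT) : forall i : bool, true -> F i = G i.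
  apply: (normC_sum_upper FG).
  by rewrite !big_bool /= abE addrC subrK.
by rewrite /F /G mulr1.
Qed.

Theorem theorem2p1 (R : realType) :
  (forall (X : normedModType R) (x0 : X), unit_sphere X x0 ->
     (exists B : set X, [/\ hamel_basis B, B x0 & strongly_orthonormal B x0]) ->
     extreme_point (unit_ball X) x0) /\
  (forall (X : normedModType R[i]) (x0 : X), unit_sphere X x0 ->
     (exists B : set X, [/\ hamel_basis B, B x0 & strongly_orthonormal B x0]) ->
     extreme_point (unit_ball X) x0).
Proof.
split=> X x0 _ [B [hB _ soB]]; apply: (strongly_orthonormal_extreme _ _ _ _ _ hB soB).
- exact: unit_convex_comb_real.
- exact: unit_convex_comb_closed.
Qed.
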